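(* Let $\alpha$ be an irrational number and let $\beta>0$ be such that $\mu(\alpha,\beta)=+\infty$. Let $\rho$ be a real number, let $(e_j)_{j\ge0}=(e_j(\rho))_{j\ge0}$ be the digits in its Ostrowski expansion with base $\alpha$, and let $\kappa_n=\sum_{j=0}^n e_j q_j$ for $n\ge0$. Let $w_k=k^{\beta}\cdot\{k\alpha-\rho\}_2$ for $k\in\mathbb{N}$. Then the sequence $(w_k)_{k\in\mathbb{N}}$ is dense in $\mathbb{R}$ if and only if the subsequence $(w_k)_{k\in\mathfrak{D}}$ is dense in $\mathbb{R}$, where $$\mathfrak{D}=\bigcup_{n=1}^{+\infty}\left(\mathcal{N}_\rho(n)\cup\mathcal{N}'_\rho(n)\right)$$ with $$\mathcal{N}_\rho(n)=\mathcal{N}_\rho\left(\kappa_n,\alpha,\|q_n\alpha\|\right)\quad\text{and}\quad\mathcal{N}'_\rho(n)=\mathcal{N}_\rho\left(\kappa_{n-1}+q_n,\alpha,\frac{\|q_{n-1}\alpha\|}{1+e_{n-1}^{\beta}}\right).$$ Moreover, the inclusions $$\{\kappa_n\}_{n\in\mathbb{N}}\subseteq\mathfrak{D}\quad\text{and}\quad\mathfrak{D}\subseteq\bigcup_{n=0}^{+\infty}\left(\mathcal{M}_\rho(n)\cup\mathcal{M}'_\rho(n)\right)$$ hold, where $$\mathcal{M}_\rho(n)=\bigcup_{l=0}^{2}\left\{\kappa_n+(e_{n+1}-l)\cdot q_{n+1}\right\}\quad\text{and}\quad\mathcal{M}'_\rho(n)=\bigcup_{l=0}^{1}\left\{\kappa_n+(l+1)q_n,\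 \kappa_n+q_{n+1}-l\,q_n\right\}.$$
   Context: $\mathbb{N}=\{1,2,3,\dots\}$. For $x\in\mathbb{R}$, $\{x\}$ is the fractional part, $\|x\|$ the distance to the nearest integer, and $\{x\}_2$ the signed fractional part, the unique number in $[-\frac12,\frac12)$ with $x-\{x\}_2\in\mathbb{Z}$. For irrational $\alpha$ and $\beta>0$, $\mu(\alpha,\beta)=\min\{\mu_+(\alpha,\beta),\mu_-(\alpha,\beta)\}$ where $$\mu_+(\alpha,\beta)=\liminf_{k\to+\infty,\ \{k\alpha\}_2>0}k^\beta\{k\alpha\}_2,\qquad \mu_-(\alpha,\beta)=\liminf_{k\to+\infty,\ \{k\alpha\}_2<0}-k^\beta\{k\alpha\}_2 .$$ For $\rho\in\mathbb{R}$, irrational $\alpha$, a natural number $N$ and $\epsilon>0$, the inhomogeneous Bohr set is $\mathcal{N}_\rho(N,\alpha,\epsilon)=\{k\in\mathbb{N}:\ k\le N,\ \|k\alpha-\rho\|\le\epsilon\}$. Let $\alpha=[a_0;a_1,a_2,\dots]$ be the continued fraction expansion of $\alpha$ and $q_n$ the denominators of its convergents ($q_0=1$, $q_1=a_1$, $q_{n+1}=a_{n+1}q_n+q_{n-1}$). The Ostrowski expansion of $\rho\in\mathbb{R}$ with base $\alpha$ is $$\rho=\rho_0+e_0(\rho)\{\alpha\}+\sum_{n=1}^{\infty}e_n(\rho)\{q_n\alpha\}_2,$$ with $\rho_0\in\mathbb{Z}$, $\rho-\rho_0\in[-\{\alpha\},1-\{\alpha\})$, and integers $0\le e_0(\rho)\le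 a_1-1$, $0\le e_n(\rho)\le a_{n+1}$ for $n\ge1$, such that $e_n(\rho)=0$ whenever $e_{n+1}(\rho)=a_{n+2}$ ($n\ge0$).
   Formalization: The inclusion {κ_n} ⊆ 𝔇 is stated only for those κ_n that are positive (κ_n = 0 when ρ = 0), and the set containing 𝔇 is enlarged by the two elements e_0 and e_0 − 1, without which the second inclusion fails, e.g. for α = [0;4,6,…] with digits 1,3,0,0,…. *)

(* Defs.v *)
From HB Require Import structures.
From mathcomp Require Import all_boot all_order all_algebra.
From mathcomp Require Import all_classical all_reals all_analysis.

Set Implicit Arguments.
Unset Strict Implicit.
Unset Printing Implicit Defensive.

Import Order.TTheory GRing.Theory Num.Theory.
Import numFieldNormedType.Exports.

Local Open Scope classical_set_scope.
Local Open Scope ring_scope.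

Definition frac (R : realType) (x : R) : R := x - (Num.floor x)%:~R.

Definition sfrac (R : realType) (x : R) : R := x - (Num.floor (x + 2^-1))%:~R.

Lemma sfrac_itv (R : realType) (x : R) : - 2^-1 <= sfrac x < 2^-1.
Proof.
have /andP[lo hi] := floor_itv (x + 2^-1).
rewrite intrD in hi; rewrite /sfrac; apply/andP; split.
  by rewrite lerBrDr addrC lerBlDr.
have h2 : (1 : R) = 2^-1 + 2^-1 by rewrite -div1r -splitr.
by move: hi; rewrite [X in _ < _ + X]h2 addrA ltrD2r ltrBlDl.
Qed.

Definition dist_int (R : realType) (x : R) : R :=
  inf [set `|x - m%:~R| | m in [set: int]].

(* The condition "{k alpha}_2 > 0" (resp. "< 0") under the lower limit is
   imposed by restricting the filter \oo to the indices that satisfy it. *)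
Definition mu_plus (R : realType) (alpha beta : R) : \bar R :=
  limf_einf (fun k : nat => (k%:R `^ beta * sfrac (k%:R * alpha))%:E)
    (within [set k : nat | 0 < sfrac (k%:R * alpha)] \oo).

Definition mu_minus (R : realType) (alpha beta : R) : \bar R :=
  limf_einf (fun k : nat => (- (k%:R `^ beta * sfrac (k%:R * alpha)))%:E)
    (within [set k : nat | sfrac (k%:R * alpha) < 0] \oo).

Definition mu (R : realType) (alpha beta : R) : \bar R :=
  Order.min (mu_plus alpha beta) (mu_minus alpha beta).

Fixpoint cf_quot (R : realType) (alpha : R) (n : nat) : R :=
  if n is m.+1 then (frac (cf_quot alpha m))^-1 else alpha.

Definition cf_coef (R : realType) (alpha : R) (n : nat) : int :=
  Num.floor (cf_quot alpha n).

(* The partial quotients of index n >= 1 are positive for irrational alpha, so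
   they can be read as natural numbers; the integer a_0, which may be negative,
   never enters below. *)
Definition cf_digit (R : realType) (alpha : R) (n : nat) : nat :=
  `|cf_coef alpha n|%N.

Fixpoint cf_den (R : realType) (alpha : R) (n : nat) : nat :=
  match n with
  | 0 => 1%N
  | 1 => cf_digit alpha 1%N
  | (m.+1 as m').+1 =>
      (cf_digit alpha m.+2 * cf_den alpha m' + cf_den alpha m)%N
  end.

(* These constraints determine the digits except when rho = - m * alpha modulo
   1 with m >= 2, where two sequences satisfy them; "the" expansion is then read
   as either of the two. *)
Definition is_ostrowski (R : realType) (alpha rho : R) (e : nat -> nat) : Prop :=
  exists rho0 : int,
    [/\ - frac alpha <= rho - rho0%:~R < 1 - frac alpha,
        (fun N : nat => rho0%:~R + (e 0%N)%:R * frac alpha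
           + \sum_(1 <= n < N) (e n)%:R * sfrac ((cf_den alpha n)%:R * alpha))
          @ \oo --> rho,
        (e 0%N <= cf_digit alpha 1 - 1)%N,
        (forall n : nat, (1 <= n)%N -> (e n <= cf_digit alpha n.+1)%N) &
        (forall n : nat, e n.+1 = cf_digit alpha n.+2 -> e n = 0%N)].

Definition kappa (R : realType) (alpha : R) (e : nat -> nat) (n : nat) : nat :=
  (\sum_(0 <= j < n.+1) e j * cf_den alpha j)%N.

Definition bohr (R : realType) (rho : R) (N : nat) (alpha eps : R) : set nat :=
  [set k : nat | (1 <= k <= N)%N /\ dist_int (k%:R * alpha - rho) <= eps].

Definition w (R : realType) (alpha beta rho : R) (k : nat) : R :=
  k%:R `^ beta * sfrac (k%:R * alpha - rho).

Definition calN (R : realType) (alpha rho : R) (e : nat -> nat) (n : nat) :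
    set nat :=
  bohr rho (kappa alpha e n) alpha (dist_int ((cf_den alpha n)%:R * alpha)).

Definition calN' (R : realType) (alpha beta rho : R) (e : nat -> nat)
    (n : nat) : set nat :=
  bohr rho (kappa alpha e n.-1 + cf_den alpha n)%N alpha
    (dist_int ((cf_den alpha n.-1)%:R * alpha) / (1 + (e n.-1)%:R `^ beta)).

Definition frakD (R : realType) (alpha beta rho : R) (e : nat -> nat) :
    set nat :=
  \bigcup_(n in [set n : nat | (1 <= n)%N])
    (calN alpha rho e n `|` calN' alpha beta rho e n).

(* Sets of integers: kappa_n + (e_(n+1) - l) * q_(n+1) may be negative, and
   truncated subtraction on nat would add spurious elements. *)
Definition calM (R : realType) (alpha : R) (e : nat -> nat) (n : nat) :
    set int :=
  \bigcup_(l in [set l : nat | (l <= 2)%N])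
    [set (kappa alpha e n)%:Z
         + ((e n.+1)%:Z - l%:Z) * (cf_den alpha n.+1)%:Z].

Definition calM' (R : realType) (alpha : R) (e : nat -> nat) (n : nat) :
    set int :=
  \bigcup_(l in [set l : nat | (l <= 1)%N])
    [set (kappa alpha e n)%:Z + (l%:Z + 1) * (cf_den alpha n)%:Z;
         (kappa alpha e n)%:Z + (cf_den alpha n.+1)%:Z
           - l%:Z * (cf_den alpha n)%:Z].

(* The elements kappa_(-1) + (e_0 - l) * q_0 for l = 0, 1, with kappa_(-1) = 0.
   They can belong to frakD without belonging to any calM n or calM' n, n >= 0:
   kappa_0 = 1 does for alpha = [0; 4, 6, ...] and digits 1, 3, 0, 0, ... *)
Definition calM_init (R : realType) (alpha : R) (e : nat -> nat) : set int :=
  \bigcup_(l in [set l : nat | (l <= 1)%N])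
    [set ((e 0%N)%:Z - l%:Z) * (cf_den alpha 0%N)%:Z].

(* Main.v *)
(* Let [d_n = |q_n alpha - p_n|], the sign of [q_n alpha - p_n] being [(-1)^n].

   Density.  Let [k] be outside [D] and choose [n] with
   [kappa_(n-1) + q_n < k <= kappa_n + q_(n+1)].  If [k <= kappa_n], then [k] is
   not in [N(n)], so [||k alpha - rho|| > d_n] and [|w_k| > q_n^beta d_n].
   Otherwise [k] is not in [N'(n+1)], so
   [||k alpha - rho|| > d_n / (1 + e_n^beta)], while [k] is at least [q_n] and
   [e_n q_n]; hence [2 |w_k| > q_n^beta d_n].  Since [mu = +oo] forces
   [q_n^beta d_n] to tend to infinity, only finitely many [k] outside [D] have
   [w_k] in a given bounded set, and these do not affect density.

   Inclusions.  Up to the sign [(-1)^n], [rho - kappa_n alpha] lies modulo 1 in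
   [[- d_n, d_(n+1)]].  For [k] in [D] the integer [kappa_n - k] is therefore a
   combination [u q_n + v q_(n+1)] of bounded size whose signed error
   [u d_n - v d_(n+1)] lies in a short interval, which leaves only a few pairs
   [(u, v)]. *)
Require Import Defs.
From mathcomp Require Import all_boot all_order all_algebra.
From mathcomp Require Import all_classical all_reals all_analysis.
From mathcomp Require Import ring lra zify.

Import Order.TTheory GRing.Theory Num.Theory.
Import numFieldNormedType.Exports.

Local Open Scope classical_set_scope.
Local Open Scope ring_scope.

(* Otherwise [frac] is the fraction of a pair in a fraction field. *)
Local Notation frac := Defs.frac.

(** * Signed fractional part and distance to the nearest integer *)

Lemma sfrac_small (R : realType) (x : R) (m : int) :
  `|x - m%:~R| < 2^-1 -> sfrac x = x - m%:~R.
Proof.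
rewrite ltr_norml => /andP[lo hi]; rewrite /sfrac (@floor_def _ _ m)//.
rewrite intrD; apply/andP; split; lra.
Qed.

Lemma dist_int_le (R : realType) (x : R) (m : int) :
  dist_int x <= `|x - m%:~R|.
Proof. by apply: ge_inf; [exists 0 => _ [k _ <-] | exists m]. Qed.

(** Since [sfrac x] lies in [-1/2, 1/2), trading its integer for another one shifts it by at least 1
    and cannot bring it closer to 0. *)
Lemma dist_intE (R : realType) (x : R) : dist_int x = `|sfrac x|.
Proof.
apply/eqP; rewrite eq_le dist_int_le /=; apply: lb_le_inf.
  by exists `|x - 0%:~R|, 0.
move=> _ [m _ <-]; set f := Num.floor (x + 2^-1).
have /andP[lo hi] := sfrac_itv x.
have -> : x - m%:~R = sfrac x + (f - m)%:~R :> R by rewrite intrB /sfrac; ring.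
have [->|fm] := eqVneq f m; first by rewrite subrr addr0.
have : (1 : R) <= `|(f - m)%:~R|.
  by rewrite -intr_norm ler1z -gtz0_ge1 normr_gt0 subr_eq0.
by case: (ger0P (f - m)%:~R) => ?; case: (ger0P (sfrac x)) => ?;
  case: (ger0P (sfrac x + _)) => ?; lra.
Qed.

Lemma dist_intP (R : realType) (x : R) :
  exists m : int, `|x - m%:~R| = dist_int x.
Proof. by rewrite dist_intE; eexists. Qed.

Lemma dist_int_ge0 (R : realType) (x : R) : 0 <= dist_int x.
Proof. by rewrite dist_intE. Qed.

(** * Continued fractions: convergents, their errors and the lattice they span *)

Section ContinuedFraction.
Variables (R : realType) (alpha : R).
Hypothesis alpha_irr : irrational alpha.

Local Notation a := (cf_digit alpha).
Local Notation q := (cf_den alpha).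

Fixpoint cf_num (n : nat) : int :=
  match n with
  | 0 => cf_coef alpha 0
  | 1 => cf_coef alpha 0 * (a 1)%:Z + 1
  | (m.+1 as m').+1 => (a m.+2)%:Z * cf_num m' + cf_num m
  end.

Local Notation p := cf_num.

(** A product over the orbit of the Gauss map, which makes positivity and decrease immediate;
    [cf_errorE] identifies it with the error of the convergent. *)
Definition cf_gap (n : nat) : R := \prod_(j < n.+1) frac (cf_quot alpha j).

Local Notation d := cf_gap.

Lemma cf_den_rec n : q n.+2 = (a n.+2 * q n.+1 + q n)%N.
Proof. by []. Qed.

Lemma cf_num_rec n : p n.+2 = (a n.+2)%:Z * p n.+1 + p n.
Proof. by []. Qed.

Lemma irrationalB_int (x : R) (m : int) :
  irrational x -> irrational (x - m%:~R).
Proof.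
move=> ix [r _ rx]; apply: ix; exists (r + m%:~R) => //.
by rewrite rmorphD rmorph_int /= rx subrK.
Qed.

Lemma irrationalV (x : R) : irrational x -> irrational x^-1.
Proof.
move=> ix [r _ rx]; apply: ix; exists r^-1 => //.
by rewrite fmorphV /= rx invrK.
Qed.

Lemma cf_quot_irr n : irrational (cf_quot alpha n).
Proof. by elim: n => //= n IH; exact/irrationalV/irrationalB_int. Qed.

Lemma frac_cf_itv n : 0 < frac (cf_quot alpha n) < 1.
Proof.
have /andP[lo hi] := floor_itv (cf_quot alpha n).
rewrite intrD in hi; rewrite /frac lt_neqAle eq_sym; apply/andP; split.
  apply/andP; split; last lra.
  apply: contra_notN (@irrationalB_int _ (Num.floor (cf_quot alpha n))
    (@cf_quot_irr n)).
  by move/eqP => ->; exists 0 => //; rewrite rmorph0.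
lra.
Qed.

Lemma cf_digit_gt0 n : (0 < a n.+1)%N.
Proof.
have /andP[f0 f1] := frac_cf_itv n.
rewrite /cf_digit absz_gt0 /cf_coef /= gt_eqF// floor_gt0.
by rewrite invf_ge1// ltW.
Qed.

Lemma cf_digitE n :
  (a n.+1)%:R = (frac (cf_quot alpha n))^-1 - frac (cf_quot alpha n.+1) :> R.
Proof.
rewrite {2}/frac [cf_quot alpha n.+1]/= opprB addrC subrK.
have := cf_digit_gt0 n; rewrite /cf_digit /cf_coef.
have : 0 <= Num.floor (cf_quot alpha n.+1).
  by rewrite floor_ge0 /= invr_ge0 ltW//; case/andP: (frac_cf_itv n).
by rewrite /=; case: (Num.floor _).
Qed.

Lemma cf_gap0 : d 0 = frac alpha.
Proof. by rewrite /cf_gap big_ord1. Qed.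

Lemma cf_gapS n : d n.+1 = d n * frac (cf_quot alpha n.+1).
Proof. by rewrite /cf_gap big_ord_recr. Qed.

Lemma cf_gap_rec0 : 1 = (a 1)%:R * d 0 + d 1.
Proof.
rewrite cf_gapS cf_gap0 cf_digitE.
have /andP[f0 _] := frac_cf_itv 0; rewrite [cf_quot alpha 0]/= in f0 *.
by field; rewrite gt_eqF.
Qed.

Lemma cf_gap_rec n : d n = (a n.+2)%:R * d n.+1 + d n.+2.
Proof.
rewrite !cf_gapS cf_digitE.
by have /andP[f0 _] := frac_cf_itv n.+1; field; rewrite gt_eqF.
Qed.

Lemma cf_gap_gt0 n : 0 < d n.
Proof.
by apply: prodr_gt0 => j _; case/andP: (frac_cf_itv j).
Qed.

Lemma cf_gapS_lt n : d n.+1 < d n.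
Proof.
rewrite cf_gapS.
by case/andP: (frac_cf_itv n.+1) => ? ?; rewrite gtr_pMr // cf_gap_gt0.
Qed.

(** From 1 = a_1 d_0 + d_1 and d_1 < d_0 follows 2 d_1 < 1. The index starts at 1 because d_0 =
    {alpha} may exceed 1/2. *)
Lemma cf_gap_lt_half n : d n.+1 < 2^-1.
Proof.
have : d 1 < 2^-1.
  have := cf_gap_rec0; have := cf_gapS_lt 0; have := cf_gap_gt0 0.
  have : (1 : R) <= (a 1)%:R by rewrite ler1n cf_digit_gt0.
  nra.
by elim: n => // n IH /IH; exact/lt_trans/cf_gapS_lt.
Qed.

(** Both sides obey the same second-order recurrence, so the induction carries two consecutive
    indices. *)
Lemma cf_errorE n :
  (q n)%:R * alpha - (p n)%:~R = (-1) ^+ n * d n.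
Proof.
suff [] : (q n)%:R * alpha - (p n)%:~R = (-1) ^+ n * d n /\
  (q n.+1)%:R * alpha - (p n.+1)%:~R = (-1) ^+ n.+1 * d n.+1 by [].
elim: n => [|n [IH1 IH2]].
  have E0 : alpha - (cf_coef alpha 0)%:~R = d 0 by rewrite cf_gap0.
  split; first by rewrite /= mul1r expr0 mul1r.
  have := cf_gap_rec0; rewrite -E0 /= intrD intrM expr1 -pmulrn => H.
  by rewrite -[1%:~R]/(1 : R) [in X in _ - (_ + X)]H; ring.
split=> //; have H := cf_gap_rec n.
rewrite cf_den_rec cf_num_rec natrD natrM intrD intrM -pmulrn.
have -> : d n.+2 = d n - (a n.+2)%:R * d n.+1 by rewrite [in RHS]H; ring.
transitivity ((a n.+2)%:R * ((q n.+1)%:R * alpha - (p n.+1)%:~R)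
  + ((q n)%:R * alpha - (p n)%:~R)); first ring.
by rewrite IH1 IH2 !exprS; ring.
Qed.

Lemma sfrac_cf_den n : sfrac ((q n.+1)%:R * alpha) = (-1) ^+ n.+1 * d n.+1.
Proof.
rewrite -cf_errorE; apply: sfrac_small; rewrite cf_errorE.
by rewrite normrM normrX normrN1 expr1n mul1r gtr0_norm ?cf_gap_gt0 ?cf_gap_lt_half.
Qed.

Lemma dist_int_cf_den n : dist_int ((q n.+1)%:R * alpha) = d n.+1.
Proof.
by rewrite dist_intE sfrac_cf_den normrM normrX normrN1 expr1n mul1r
  gtr0_norm ?cf_gap_gt0.
Qed.

Lemma dist_int_cf_den_le n : dist_int ((q n)%:R * alpha) <= d n.
Proof.
apply: (le_trans (dist_int_le _ _ (p n))).
by rewrite cf_errorE normrM normrX normrN1 expr1n mul1r gtr0_norm ?cf_gap_gt0.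
Qed.

Lemma cf_den_gt0 n : (0 < q n)%N.
Proof.
suff /andP[] : ((0 < q n) && (0 < q n.+1))%N by [].
elim: n => [|n /andP[IH1 IH2]]; first by rewrite /= cf_digit_gt0.
by rewrite IH2 cf_den_rec addn_gt0 IH1 orbT.
Qed.

Lemma cf_denS_lt n : (q n.+1 < q n.+2)%N.
Proof.
rewrite cf_den_rec; have := cf_den_gt0 n; have := cf_den_gt0 n.+1.
have := cf_digit_gt0 n.+1; nia.
Qed.

Lemma cf_denS_le n : (q n <= q n.+1)%N.
Proof. by case: n => [|n]; rewrite ?cf_den_gt0// ltnW ?cf_denS_lt. Qed.

Lemma cf_den_ge n : (n <= q n)%N.
Proof.
case: n => // n; elim: n => [|n IH]; first exact: cf_den_gt0.
exact: leq_ltn_trans IH (cf_denS_lt n).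
Qed.

(* Consecutive convergents span Z^2: the determinant is +-1. *)
Lemma cf_basis n (m k : int) : exists u v : int,
  m = u * (q n)%:Z + v * (q n.+1)%:Z /\ k = u * p n + v * p n.+1.
Proof.
elim: n m k => [|n IH] m k.
  exists (m - (k - cf_coef alpha 0 * m) * (a 1)%:Z), (k - cf_coef alpha 0 * m).
  by split => /=; ring.
have [u [v [-> ->]]] := IH m k.
exists (v - (a n.+2)%:Z * u), u.
by rewrite cf_den_rec PoszD PoszM cf_num_rec; split; ring.
Qed.

(** Consecutive convergents err on opposite sides of alpha, hence the minus sign; the factor (-1)^n
    lets even and odd n be treated alike. *)
Lemma cf_repr n (m k : int) : exists u v : int,
  m = u * (q n)%:Z + v * (q n.+1)%:Z /\
  (-1) ^+ n * (m%:~R * alpha - k%:~R) = u%:~R * d n - v%:~R * d n.+1 :> R.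
Proof.
have [u [v [-> ->]]] := cf_basis n m k; exists u, v; split => //.
rewrite !intrD !intrM -!pmulrn.
have H1 := cf_errorE n; have H2 := cf_errorE n.+1.
transitivity ((-1) ^+ n * (u%:~R * ((q n)%:R * alpha - (p n)%:~R)
  + v%:~R * ((q n.+1)%:R * alpha - (p n.+1)%:~R))); first ring.
rewrite H1 H2 exprS.
have S : (-1) ^+ n * (-1) ^+ n = 1 :> R by rewrite -expr2 sqrr_sign.
by ring: S.
Qed.

End ContinuedFraction.

(** * Small integers m for which m alpha is close to an integer *)

Section LatticePoints.
Variables (R : realType) (alpha : R).
Hypothesis alpha_irr : irrational alpha.

Local Notation q := (cf_den alpha).
Local Notation d := (cf_gap R alpha).

Local Lemma intr_mulr_le (u t : int) (x : R) :
  0 < x -> u <= t -> u%:~R * x <= t%:~R * x.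
Proof. by move=> x0 ut; rewrite ler_pM2r// ler_int. Qed.

(** Meant for m = kappa_n - k with k <= kappa_n. In the coordinates (u, v) of [cf_repr], the range
    of m makes u <= -1 if v >= 1 and u >= 2 if v <= -1. Then u d_n - v d_(n+1) leaves the interval,
    except at (-1, 1), which gives the left endpoint; v = 0 leaves u = 0, 1, 2. *)
Lemma near_left_multiples n (m k : int) :
  (q n < q n.+1)%N -> 0 <= m < (q n.+1)%:Z ->
  let x := (-1) ^+ n * (m%:~R * alpha - k%:~R) : R in
  - (d n + d n.+1) <= x <= 2 * d n ->
  [\/ m = 0, m = (q n)%:Z, m = 2 * (q n)%:Z /\ x = 2 * d n |
      m = (q n.+1)%:Z - (q n)%:Z /\ x = - (d n + d n.+1)].
Proof.
move=> ltq /andP[m0 mq] x; rewrite {}/x.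
have [u [v [Em ->]]] := cf_repr R alpha alpha_irr n m k.
have q0 := cf_den_gt0 R alpha alpha_irr n.
have d0 := cf_gap_gt0 R alpha alpha_irr n.
have d1 := cf_gap_gt0 R alpha alpha_irr n.+1.
have dd := cf_gapS_lt R alpha alpha_irr n.
move=> /andP[lo hi].
have [v1|v1] := leP 1 v; last have [v0|v0] := leP 0 v.
- have u1 : u <= -1 by nia.
  have ur : u%:~R * d n <= -1 * d n := intr_mulr_le u (-1) _ d0 ltac:(lia).
  have vr : 1 * d n.+1 <= v%:~R * d n.+1 := intr_mulr_le 1 v _ d1 ltac:(lia).
  have [u2|u2] := leP u (-2).
    have u2r : u%:~R * d n <= -2 * d n := intr_mulr_le u (-2) _ d0 ltac:(lia).
    by suff: d n < d n; [rewrite ltxx | lra].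
  have {}u2 : u = -1 by lia.
  have [v2|v2] := leP 2 v.
    have v2r : 2 * d n.+1 <= v%:~R * d n.+1 := intr_mulr_le 2 v _ d1 ltac:(lia).
    by suff: d n < d n; [rewrite ltxx | lra].
  have {}v2 : v = 1 by lia.
  by apply: Or44; subst u v; split; [rewrite Em; lia | ring].
- have {v0 v1}v0 : v = 0 by lia.
  subst v; rewrite mul0r addr0 mulr0z mul0r subr0 in Em lo hi *.
  have u0 : 0 <= u by nia.
  have [u3|u3] := leP 3 u.
    have u3r : 3 * d n <= u%:~R * d n := intr_mulr_le 3 u _ d0 ltac:(lia).
    by suff: d n < d n; [rewrite ltxx | lra].
  have [u0'|u0'] := leP u 0; first by apply: Or41; rewrite Em; nia.
  have [u1'|u1'] := leP u 1; first by apply: Or42; rewrite Em; nia.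
  have u2 : u = 2 by lia.
  by apply: Or43; subst u.
- have u2 : 2 <= u by nia.
  have ur : 2 * d n <= u%:~R * d n := intr_mulr_le 2 u _ d0 ltac:(lia).
  have vr : v%:~R * d n.+1 <= -1 * d n.+1 := intr_mulr_le v (-1) _ d1 ltac:(lia).
  by suff: d n < d n; [rewrite ltxx | lra].
Qed.

(** Meant for m = k - kappa_n with k > kappa_n, hence the mirrored interval. The same split on v
    leaves essentially (1, 0), (0, 1) and (-1, 1). *)
Lemma near_right_multiples n (m k : int) :
  1 <= m <= (q n.+1)%:Z ->
  - (2 * d n) <= (-1) ^+ n * (m%:~R * alpha - k%:~R) <= d n + d n.+1 ->
  [\/ m = (q n)%:Z, m = (q n.+1)%:Z | m = (q n.+1)%:Z - (q n)%:Z].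
Proof.
move=> /andP[m0 mq].
have [u [v [Em ->]]] := cf_repr R alpha alpha_irr n m k.
have q0 := cf_den_gt0 R alpha alpha_irr n.
have qq := cf_denS_le R alpha alpha_irr n.
have d0 := cf_gap_gt0 R alpha alpha_irr n.
have d1 := cf_gap_gt0 R alpha alpha_irr n.+1.
have dd := cf_gapS_lt R alpha alpha_irr n.
move=> /andP[lo hi].
have [v1|v1] := leP 1 v; last have [v0|v0] := leP 0 v.
- have u1 : u <= 0 by nia.
  have vr : 1 * d n.+1 <= v%:~R * d n.+1 := intr_mulr_le 1 v _ d1 ltac:(lia).
  have [u2|u2] := leP u (-2).
    have u2r : u%:~R * d n <= -2 * d n := intr_mulr_le u (-2) _ d0 ltac:(lia).
    by suff: d n < d n; [rewrite ltxx | lra].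
  have [u0|u0] := leP 0 u; first by apply: Or32; rewrite Em; nia.
  have {}u2 : u = -1 by lia.
  subst u; have [v2|v2] := leP v 1; first by apply: Or33; rewrite Em; nia.
  (* Here m <= q_(n+1) forces v = 2 and q_n = q_(n+1), so m is again q_(n+1). *)
  by apply: Or32; nia.
- have {v0 v1}v0 : v = 0 by lia.
  subst v; rewrite mul0r addr0 mulr0z mul0r subr0 in Em lo hi *.
  have u0 : 1 <= u by nia.
  have [u3|u3] := leP 2 u.
    have u3r : 2 * d n <= u%:~R * d n := intr_mulr_le 2 u _ d0 ltac:(lia).
    by suff: d n < d n; [rewrite ltxx | lra].
  by apply: Or31; rewrite Em; nia.
- have u2 : 2 <= u by nia.
  have ur : 2 * d n <= u%:~R * d n := intr_mulr_le 2 u _ d0 ltac:(lia).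
  have vr : v%:~R * d n.+1 <= -1 * d n.+1 := intr_mulr_le v (-1) _ d1 ltac:(lia).
  by suff: d n < d n; [rewrite ltxx | lra].
Qed.

End LatticePoints.

(** * Ostrowski digits: size of kappa_n and approximation of rho *)

Section Ostrowski.
Variables (R : realType) (alpha rho : R) (e : nat -> nat).
Hypothesis alpha_irr : irrational alpha.
Hypothesis e_digits : is_ostrowski alpha rho e.

Local Notation a := (cf_digit alpha).
Local Notation q := (cf_den alpha).
Local Notation p := (cf_num R alpha).
Local Notation d := (cf_gap R alpha).
Local Notation kap := (kappa alpha e).

Lemma kappa0 : kap 0 = e 0.
Proof. by rewrite /kappa big_nat1 /= muln1. Qed.

Lemma kappaS n : kap n.+1 = (kap n + e n.+1 * q n.+1)%N.
Proof. by rewrite /kappa big_nat_recr. Qed.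

(** A maximal digit e_(n+1) = a_(n+2) would overshoot unless kappa_n <= q_n. The digit rule then
    gives e_n = 0, so the induction also carries the sharper bound for vanishing e_n. *)
Lemma kappa_le n : (kap n <= q n.+1)%N.
Proof.
have [_ [_ _ e0 en eS]] := e_digits.
suff [] : (kap n <= q n.+1)%N /\ (e n = 0 -> kap n <= q n)%N by [].
elim: n => [|n [IH1 IH2]].
  by rewrite kappa0 /=; split; [lia | move=> ->].
rewrite kappaS cf_den_rec; split; last by move=> ->; lia.
have := en n.+1 isT; rewrite leq_eqVlt => /orP[/eqP ea|ea].
  by have := IH2 (eS _ ea); rewrite ea; lia.
nia.
Qed.

Lemma kappaS_le n : (kap n <= (1 + e n) * q n)%N.
Proof.
case: n => [|n]; first by rewrite kappa0 /=; lia.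
by rewrite kappaS; have := kappa_le n; nia.
Qed.

(* [e_j d_j <= a_(j+1) d_j = d_(j-1) - d_(j+1)], so the terms of either sign
   telescope. *)
Lemma ostrowski_tail_itv n m :
  - d n <= (-1) ^+ n * \sum_(n.+1 <= j < n.+1 + m) (e j)%:R * sfrac ((q j)%:R * alpha)
    <= d n.+1.
Proof.
have [_ [_ _ _ en _]] := e_digits.
elim: m n => [|m IH] n.
  rewrite addn0 big_geq// mulr0 oppr_le0.
  by rewrite !ltW ?cf_gap_gt0.
rewrite big_ltn; last by rewrite addnS ltnS leq_addr.
rewrite -addSnnS sfrac_cf_den// mulrDr.
set S := \sum_(_ <= _ < _) _; have /andP[lo hi] : - d n.+1 <= (-1) ^+ n.+1 * S <= d n.+2 := IH n.+1.
rewrite exprS mulN1r mulNr in lo hi.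
have -> : (-1) ^+ n * ((e n.+1)%:R * ((-1) ^+ n.+1 * d n.+1))
  = - ((e n.+1)%:R * d n.+1) :> R.
  have sg : (-1) ^+ n * (-1) ^+ n = 1 :> R by rewrite -expr2 sqrr_sign.
  by rewrite exprS; ring: sg.
have d1 := cf_gap_gt0 R alpha alpha_irr n.+1.
have rc := cf_gap_rec R alpha alpha_irr n.
have : (e n.+1)%:R <= (a n.+2)%:R :> R by rewrite ler_nat en.
have : 0 <= (e n.+1)%:R :> R by [].
move: ((-1) ^+ n * S) lo hi => T *; apply/andP; split; nra.
Qed.

(** Modulo 1 the partial sum up to index n is kappa_n alpha, because {q_j alpha}_2 = q_j alpha - p_j
    for j >= 1 and {alpha} = alpha - p_0. The bounds on finite tails survive the limit. *)
Lemma kappa_approx n : exists k : int,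
  - d n <= (-1) ^+ n * (rho - ((kap n)%:R * alpha - k%:~R)) <= d n.+1.
Proof.
have [rho0 [_ cvg_rho _ _ _]] := e_digits.
exists (- rho0 + \sum_(0 <= j < n.+1) (e j)%:Z * p j).
set c := _ * _ - _.
have Ec : c = rho0%:~R + (e 0%N)%:R * frac alpha
  + \sum_(1 <= j < n.+1) (e j)%:R * sfrac ((q j)%:R * alpha).
  rewrite /c /kappa intrD intrN big_nat_recl// [in X in - X]big_nat_recl//.
  rewrite natrD natr_sum intrD rmorph_sum big_add1 [n.+1.-1]/= /frac intrM muln1.
  rewrite -!pmulrn.
  have -> : \sum_(0 <= i < n) (e i.+1)%:R * sfrac ((q i.+1)%:R * alpha)
    = (\sum_(0 <= i < n) (e i.+1 * q i.+1)%:R) * alpha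
      - \sum_(0 <= i < n) ((e i.+1)%:Z * p i.+1)%:~R.
    rewrite mulr_suml -sumrB; apply: eq_bigr => i _.
    rewrite sfrac_cf_den// -cf_errorE// natrM intrM -pmulrn; ring.
  by rewrite -[p 0]/(Num.floor alpha); ring.
set f := fun _ => _ in cvg_rho.
have cvg_f : (fun N => (-1) ^+ n * (f N - c)) @ \oo --> (-1) ^+ n * (rho - c).
  by apply: cvgM; [exact: cvg_cst | apply: cvgB => //; exact: cvg_cst].
have tail : \forall N \near \oo, - d n <= (-1) ^+ n * (f N - c) <= d n.+1.
  near=> N.
  have nN : (n.+1 <= N)%N by near: N; exact: nbhs_infty_ge.
  rewrite Ec /f (@big_cat_nat _ _ _ n.+1 1)//=.
  have := ostrowski_tail_itv n (N - n.+1); rewrite subnKC//.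
  set S := \sum_(n.+1 <= _ < N) _; set S' := \sum_(1 <= _ < n.+1) _.
  by rewrite addrA [_ + S - _]addrAC subrr add0r.
apply/andP; split.
  apply: (ler_cvg_to (cvg_cst (- d n)) cvg_f).
  by apply: filterS tail => N /andP[].
apply: (ler_cvg_to cvg_f (cvg_cst (d n.+1))).
by apply: filterS tail => N /andP[].
Unshelve. all: by end_near. Qed.

End Ostrowski.

(** * The two inclusions for the union of Bohr sets *)

Section BohrSets.
Variables (R : realType) (alpha beta rho : R) (e : nat -> nat).
Hypothesis alpha_irr : irrational alpha.
Hypothesis beta_gt0 : 0 < beta.
Hypothesis e_digits : is_ostrowski alpha rho e.

Local Notation q := (cf_den alpha).
Local Notation d := (cf_gap R alpha).
Local Notation kap := (kappa alpha e).
Local Notation calMs :=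
  (calM_init alpha e `|` \bigcup_(n : nat) (calM alpha e n `|` calM' alpha e n)).

Lemma normr_signM n (x : R) : `|(-1) ^+ n * x| = `|x|.
Proof. by rewrite normrM normrX normrN1 expr1n mul1r. Qed.

Lemma dist_int_kappa n : dist_int ((kap n)%:R * alpha - rho) <= d n.
Proof.
have [k /andP[lo hi]] := kappa_approx R alpha rho e alpha_irr e_digits n.
apply: (le_trans (dist_int_le _ _ k)).
rewrite -normrN -(normr_signM n) ler_norml.
have -> : - ((kap n)%:R * alpha - rho - k%:~R)
  = rho - ((kap n)%:R * alpha - k%:~R) by ring.
by rewrite lo (le_trans hi)// ltW// cf_gapS_lt.
Qed.

(** Positivity is a genuine restriction: the leading digits may all vanish, while Bohr sets contain
    only positive integers. *)
Lemma kappa_frakD n : (0 < kap n.+1)%N -> frakD alpha beta rho e (kap n.+1).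
Proof.
move=> k0; exists n.+1 => //; left; split; first by rewrite k0 /=.
by rewrite dist_int_cf_den// dist_int_kappa.
Qed.

Lemma kappaB_approx n k (eps : R) :
  dist_int (k%:R * alpha - rho) <= eps -> exists k' : int,
  - (eps + d n.+1) <= (-1) ^+ n * (((kap n)%:Z - k%:Z)%:~R * alpha - k'%:~R)
    <= d n + eps.
Proof.
have [k1 /andP[lo hi]] := kappa_approx R alpha rho e alpha_irr e_digits n.
have [k2 <-] := dist_intP R (k%:R * alpha - rho).
rewrite -(normr_signM n) ler_norml => /andP[lo' hi']; exists (k1 - k2).
rewrite intrB -!pmulrn [(k1 - k2)%:~R]intrB.
set s := (-1) ^+ n in lo hi lo' hi' *.
have -> : s * (((kap n)%:R - k%:R) * alpha - (k1%:~R - k2%:~R))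
  = - (s * (rho - ((kap n)%:R * alpha - k1%:~R)))
    - s * (k%:R * alpha - rho - k2%:~R) by ring.
by apply/andP; split; lra.
Qed.

Lemma calN_calM n k : calN alpha rho e n.+1 k -> calMs k%:Z.
Proof.
rewrite /calN /bohr /= => -[/andP[k1 kk]]; rewrite dist_int_cf_den// => dk.
have [k' /andP[lo hi]] := kappaB_approx n.+1 k _ dk.
have mq : 0 <= (kap n.+1)%:Z - k%:Z < (q n.+2)%:Z.
  by have kq := kappa_le R alpha rho e e_digits n.+1; apply/andP; split; lia.
have inM l : (l <= 2)%N ->
    (kap n.+1)%:Z - k%:Z = l%:Z * (q n.+1)%:Z -> calMs k%:Z.
  move=> l2 E; right; exists n => //; left; exists l => //.
  by move: E; rewrite kappaS /= PoszD PoszM; lia.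
have ql := cf_denS_lt R alpha alpha_irr n.
have [|H|H|[H _]|[H _]] :=
  near_left_multiples R alpha alpha_irr n.+1 _ k' ql mq.
- by apply/andP; split; lra.
- by apply: (inM 0) => //; lia.
- by apply: (inM 1) => //; lia.
- by apply: (inM 2) => //; lia.
have [_ [_ _ e0 en eS]] := e_digits.
have qrec := cf_den_rec R alpha n.
have kle := kappaS_le R alpha rho e e_digits n.+1.
have kS := kappaS R alpha e n.
have q1 := cf_den_gt0 R alpha alpha_irr n.+1.
have q0 := cf_den_gt0 R alpha alpha_irr n.
have := en n.+1 isT; rewrite leq_eqVlt => /orP[/eqP ea|ea].
  rewrite ea in kS; have E : k%:Z = (kap n)%:Z + (q n.+1)%:Z - 1 * (q n)%:Z by lia.
  by right; exists n => //; right; exists 1%N => //; right; rewrite E.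
(* As k >= 1, q_(n+2) - q_(n+1) < kappa_(n+1) <= (1 + e_(n+1)) q_(n+1), which leaves only this
   digit. *)
have {}ea : (e n.+1).+1 = cf_digit alpha n.+2 by nia.
have kE : k%:Z = (kap n)%:Z - (q n)%:Z by rewrite -ea in qrec; lia.
(* Subtracting q_n lowers the digit e_n by one: this is l = 1 in [calM] at index n - 1, or in
   [calM_init] when n = 0. *)
move: (n) kE => [|j] kE.
  by left; exists 1%N => //; rewrite kE kappa0 /=; lia.
rewrite kappaS PoszD PoszM in kE; right; exists j => //; left; exists 1%N => //.
by rewrite kE /set1 mulrBl mul1r addrA.
Qed.

Lemma calN'_eps_le n :
  dist_int ((q n)%:R * alpha) / (1 + (e n)%:R `^ beta) <= d n.
Proof.
apply: (le_trans _ (dist_int_cf_den_le R alpha alpha_irr n)).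
have p0 := powR_ge0 ((e n)%:R : R) beta.
by rewrite ler_pdivrMr; [rewrite ler_peMr ?dist_int_ge0// lerDl | lra].
Qed.

Lemma calN'_calM n k : calN' alpha beta rho e n.+1 k -> calMs k%:Z.
Proof.
rewrite /calN' /bohr => -[/andP[k1]]; rewrite [n.+1.-1]/= => kk dk.
have dkn := le_trans dk (calN'_eps_le n).
have dd := cf_gapS_lt R alpha alpha_irr n.
have d0 := cf_gap_gt0 R alpha alpha_irr n.
have d1 := cf_gap_gt0 R alpha alpha_irr n.+1.
have [kn|kn] := leqP k (kap n); last first.
  have [k' /andP[lo hi]] := kappaB_approx n k _ dkn.
  have mq : 1 <= k%:Z - (kap n)%:Z <= (q n.+1)%:Z by apply/andP; split; lia.
  have [|H|H|H] := near_right_multiples R alpha alpha_irr n _ (- k') mq.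
  - have -> : (k%:Z - (kap n)%:Z)%:~R * alpha - (- k')%:~R
      = - (((kap n)%:Z - k%:Z)%:~R * alpha - k'%:~R) :> R.
      by rewrite !intrB intrN; ring.
    by rewrite mulrN; apply/andP; split; lra.
  - have E : k%:Z = (kap n)%:Z + (0 + 1) * (q n)%:Z by lia.
    by right; exists n => //; right; exists 0%N => //; left; rewrite E.
  - have E : k%:Z = (kap n)%:Z + (q n.+1)%:Z - 0 * (q n)%:Z by lia.
    by right; exists n => //; right; exists 0%N => //; right; rewrite E.
  - have E : k%:Z = (kap n)%:Z + (q n.+1)%:Z - 1 * (q n)%:Z by lia.
    by right; exists n => //; right; exists 1%N => //; right; rewrite E.
(* For n >= 1 the bounds on k already put it in [calN] at index n; only n = 0 needs a separate
   argument. *)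
case: n => [|n] in kk dk dkn dd d0 d1 kn *; last first.
  by apply: (calN_calM n); split; rewrite ?k1 ?dist_int_cf_den.
have [_ [_ _ e0 _ _]] := e_digits; rewrite kappa0 in kn.
(* As 1 <= k <= e_0, the denominator 1 + e_0^beta is at least 2. The halved radius rules out both
   extreme cases of [near_left_multiples], so that l = 0, 1 suffice in [calM_init]. *)
have dk2 : dist_int (k%:R * alpha - rho) <= d 0 / 2.
  have : 1 `^ beta <= (e 0)%:R `^ beta :> R.
    by rewrite ge0_ler_powR ?nnegrE ?ler1n ?(ltW beta_gt0)//; lia.
  rewrite powR1; have := dist_int_cf_den_le R alpha alpha_irr 0.
  set b := _ `^ _ in dk * => le_d b1; apply: (le_trans dk).
  rewrite ler_pdivrMr; last lra.
  by apply: le_trans le_d _; rewrite -mulrA ler_peMr ?(ltW d0)//; lra.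
have [k' /andP[lo hi]] := kappaB_approx 0 k _ dk2.
have ql : (q 0 < q 1)%N by rewrite /=; lia.
have mq : 0 <= (kap 0)%:Z - k%:Z < (q 1)%:Z.
  by rewrite kappa0 /=; apply/andP; split; lia.
have inM l : (l <= 1)%N -> (e 0)%:Z - k%:Z = l%:Z -> calMs k%:Z.
  by move=> l2 E; left; exists l => //=; lia.
have [|H|H|[_ H]|[_ H]] := near_left_multiples R alpha alpha_irr 0 _ k' ql mq.
- by apply/andP; split; lra.
- by apply: (inM 0) => //; rewrite kappa0 in H; lia.
- by apply: (inM 1) => //; rewrite kappa0 /= in H; lia.
- by suff: d 0 < d 0; [rewrite ltxx | lra].
- by suff: d 0 < d 0; [rewrite ltxx | lra].
Qed.

Lemma frakD_calM k : frakD alpha beta rho e k -> calMs k%:Z.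
Proof.
by move=> [[//|n] _ [|]]; [exact: calN_calM | exact: calN'_calM].
Qed.

End BohrSets.

(** * Density: growth of |w_k| outside the union of Bohr sets *)

Lemma limf_einf_within_pinfty (R : realType) (u : nat -> R) (P : set nat) :
  limf_einf (fun k => (u k)%:E) (within P \oo) = +oo%E ->
  forall M, \forall k \near \oo, P k -> M < u k.
Proof.
rewrite limf_einfE => uy M.
(* The lower limit is a supremum of infima over sets of the filter, so one of these infima exceeds
   M. *)
have /ereal_sup_gt[_ [V VP <-] MV] :
    (M%:E < ereal_sup [set ereal_inf ((fun k => (u k)%:E) @` V) | V in within P \oo])%E.
  by rewrite uy ltry.
apply: filterS VP => k Vk; rewrite -lte_fin.
by apply: lt_le_trans MV _; apply: ereal_inf_lbound; exists k.
Qed.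

(** The complement of a point is open and dense in the reals, so intersecting with it preserves
    density. *)
Lemma dense_setD_seq (R : realType) (A : set R) (s : seq R) :
  dense A -> dense (A `\` [set` s]).
Proof.
move=> dA; elim: s => [|x s IH].
  by have -> : A `\` [set` [::]] = A by apply/seteqP; split => [y []|y].
have -> : A `\` [set` x :: s] = [set~ x] `&` (A `\` [set` s]).
  apply/seteqP; split => y /=.
    by move=> [Ay]; rewrite inE => /negP; rewrite negb_or => /andP[/eqP ? /negP].
  move=> [/eqP yx [Ay /negP ys]]; split => //; apply/negP.
  by rewrite inE negb_or yx.
apply: denseI => //; last exact: dense_set1C.
by apply: closed_openC; apply: accessible_closed_set1; exact/hausdorff_accessible.
Qed.

Section Density.
Variables (R : realType) (alpha beta rho : R) (e : nat -> nat).
Hypothesis alpha_irr : irrational alpha.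
Hypothesis beta_gt0 : 0 < beta.
Hypothesis mu_infty : mu alpha beta = +oo%E.

Local Notation q := (cf_den alpha).
Local Notation d := (cf_gap R alpha).
Local Notation kap := (kappa alpha e).

(** Both lower limits are infinite; at k = q_(n+1) the signed error is (-1)^(n+1) d_(n+1), so parity
    decides which of them applies. *)
Lemma cf_den_pow_gap M : exists N, forall n, (N <= n)%N ->
  M < (q n.+1)%:R `^ beta * d n.+1.
Proof.
have [mu_p mu_m] : mu_plus alpha beta = +oo%E /\ mu_minus alpha beta = +oo%E.
  by move: mu_infty; rewrite /mu minEle; case: ifP => [le|le] E;
    move: le; rewrite E; [rewrite leye_eq => /eqP | rewrite leey].
have := filterI (limf_einf_within_pinfty _ _ _ mu_p M)
                (limf_einf_within_pinfty _ _ _ mu_m M).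
move=> [N _ HN]; exists N => n Nn.
have /HN[/=] : (N <= q n.+1)%N.
  exact: leq_trans (leq_trans Nn (leqnSn n)) (cf_den_ge R alpha alpha_irr _).
have d0 := cf_gap_gt0 R alpha alpha_irr n.+1.
rewrite -/(q n.+1) sfrac_cf_den// -signr_odd.
case: odd; rewrite ?expr1 ?expr0 ?mulN1r ?mul1r.
  by move=> _; rewrite oppr_lt0 mulrN opprK => /(_ d0).
by move=> /(_ d0).
Qed.

Lemma norm_w_gt M : exists K, forall k, (K <= k)%N ->
  ~ frakD alpha beta rho e k -> M < `|w alpha beta rho k|.
Proof.
(* The factor 2 pays for (1 + E) Q <= 2 k^beta in the last case; the absolute value covers negative
   M. *)
have [N HN] := cf_den_pow_gap (2 * `|M|).
(* This threshold makes the minimal index m below exceed N, so [HN] applies to its predecessor n. *)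
exists (kap N + q N.+1).+1 => k Kk kD.
pose P m := (k <= kap m + q m.+1)%N.
have exP : exists m, P m.
  exists k; rewrite /P; have := cf_den_ge R alpha alpha_irr k.+1; lia.
case: (ex_minnP exP) => m km mmin.
have mono i j : (i <= j)%N -> (kap i + q i.+1 <= kap j + q j.+1)%N.
  move=> /subnK <-; elim: (j - i)%N => // t; rewrite addSn => /leq_trans; apply.
  rewrite kappaS; have := cf_denS_le R alpha alpha_irr (t + i).+1.
  lia.
have Nm : (N < m)%N.
  rewrite ltnNge; apply/negP => /mono mN; rewrite /P in km; lia.
case: m => // n in km mmin Nm.
have kn : (kap n + q n.+1 < k)%N.
  by rewrite ltnNge; apply/negP => /mmin; rewrite ltnn.
have k0 : (0 < k)%N by lia.
have dkq : 2 * `|M| < (q n.+1)%:R `^ beta * d n.+1 by apply: HN.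
have Q0 := powR_ge0 ((q n.+1)%:R : R) beta.
have d0 := cf_gap_gt0 R alpha alpha_irr n.+1.
have powm i j : (i <= j)%N -> (i%:R : R) `^ beta <= j%:R `^ beta.
  by move=> ij; rewrite ge0_ler_powR ?nnegrE ?ler_nat ?(ltW beta_gt0).
have qk : (q n.+1)%:R `^ beta <= k%:R `^ beta :> R by apply: powm; lia.
rewrite /w normrM (ger0_norm (powR_ge0 _ _)) -dist_intE.
apply: le_lt_trans (ler_norm M) _.
have M0 : 0 <= `|M| by [].
set D := dist_int _.
have [kle|kgt] := leqP k (kap n.+1).
  have Dd : d n.+1 < D.
    rewrite ltNge -dist_int_cf_den//; apply/negP => Dle; apply: kD.
    by exists n.+1 => //; left; split; rewrite ?k0.
  nra.
set E := (e n.+1)%:R `^ beta : R.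
have E0 : 0 <= E := powR_ge0 _ _.
have Dd : d n.+1 < D * (1 + E).
  rewrite -ltr_pdivrMr; last lra.
  rewrite ltNge -dist_int_cf_den//; apply/negP => Dle; apply: kD.
  (* The index is n + 2 because N'(n+2) reaches up to kappa_(n+1) + q_(n+2), with radius d_(n+1) /
     (1 + e_(n+1)^beta). *)
  by exists n.+2 => //; right; split; rewrite ?k0.
have ek : E * (q n.+1)%:R `^ beta <= k%:R `^ beta.
  rewrite -powRM// -natrM; apply: powm.
  by apply: leq_trans (ltnW kgt); rewrite kappaS leq_addl.
have D0 : 0 <= D := dist_int_ge0 _ _.
set Q := (q n.+1)%:R `^ beta in dkq Q0 qk ek *.
have : Q * d n.+1 <= Q * (D * (1 + E)) by rewrite ler_wpM2l// ltW.
have : D * ((1 + E) * Q) <= D * (2 * k%:R `^ beta).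
  by rewrite ler_wpM2l//; lra.
lra.
Qed.

Lemma dense_w_frakD :
  dense (w alpha beta rho @` [set k : nat | (1 <= k)%N]) ->
  dense (w alpha beta rho @` frakD alpha beta rho e).
Proof.
move=> dw O [x Ox] oO.
have /nbhs_ballP[r /= r0 xrO] : nbhs x O by exact: open_nbhs_nbhs.
have [K HK] := norm_w_gt (`|x| + r).
(* Discarding the values w_0, ..., w_(K-1) forces the index of any point found to be at least K. *)
have [] := dense_setD_seq _ _ [seq w alpha beta rho k | k <- iota 0 K] dw (ball x r).
- by exists x; exact: ballxx.
- exact: ball_open.
move=> y [xy [[k k1 wk] ks]]; rewrite -{}wk in xy ks; exists (w alpha beta rho k); split; first exact: xrO.
exists k => //; apply: contrapT => kD.
have Kk : (K <= k)%N.
  rewrite leqNgt; apply/negP => kK; apply: ks => /=.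
  by apply: map_f; rewrite mem_iota.
have := HK k Kk kD; apply/negP; rewrite -leNgt.
rewrite /ball /= in xy.
have := ler_normB x (x - w alpha beta rho k); rewrite opprB addrC subrK.
by move/le_trans; apply; rewrite lerD2l ltW.
Qed.

End Density.

Theorem theorem1p3 (R : realType) (alpha beta rho : R) (e : nat -> nat)
    (alpha_irr : irrational alpha) (beta_gt0 : 0 < beta)
    (mu_infty : mu alpha beta = +oo%E)
    (e_digits : is_ostrowski alpha rho e) :
  [/\ dense (w alpha beta rho @` [set k : nat | (1 <= k)%N]) <->
        dense (w alpha beta rho @` frakD alpha beta rho e),
      kappa alpha e @` [set n : nat | (1 <= n)%N]
        `&` [set k : nat | (1 <= k)%N] `<=` frakD alpha beta rho e &
      [set k%:Z | k in frakD alpha beta rho e] `<=`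
        calM_init alpha e
          `|` \bigcup_(n : nat) (calM alpha e n `|` calM' alpha e n)].
Proof.
split.
- split; first exact: dense_w_frakD.
  (* Bohr sets contain only positive integers, so the values over D are among all the values. *)
  move=> dD O O0 oO; have [y [Oy [k [n n1 Dk] wk]]] := dD O O0 oO.
  exists y; split => //; exists k => //.
  by case: Dk => -[/andP[]].
- by move=> _ [[[//|n] _ <-] k0]; exact: kappa_frakD.
- by move=> _ [k kD <-]; exact: frakD_calM kD.
Qed.
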